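(* Let $A\in\mathbb{C}^{n\times n}$, $n\ge 2$, be diagonalizable with eigenvalues $\gamma_1,\dots,\gamma_n$, let $\sigma\in\mathbb{C}$ with $\sigma\neq\gamma_1$, and let $B=A-\sigma I=Z\Lambda Z^{-1}$, where $\Lambda=\mathrm{diag}(\lambda_1,\dots,\lambda_n)$ and $\lambda_j=\gamma_j-\sigma$. Let $y\in\mathbb{C}^n$ with $\|y\|_2=1$, and let $w=Z^{-1}y=[w_1,\dots,w_n]^T$ and $w^{(2)}=[w_2,\dots,w_n]^T\in\mathbb{C}^{n-1}$. Let $r_1$ be the residual after one iteration of GMRES applied to $Bx=y$ with zero initial guess. Then $$\|r_1\|_2\le C_2\,\|w^{(2)}\|_2,\qquad C_2=\|Z\|_2\max_{2\le j\le n}\frac{|\gamma_1-\gamma_j|}{|\gamma_1-\sigma|}.$$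
   Context: $\|\cdot\|_2$ is the Euclidean norm of a vector and the spectral norm of a matrix. GMRES applied to $Bx=y$ with zero initial guess: the $k$-th iterate $x_k$ minimizes $\|y-Bx\|_2$ over $x\in\mathrm{span}\{y,By,\dots,B^{k-1}y\}$, and $r_k=y-Bx_k$ is the corresponding residual. *)

(* Defs.v *)
From mathcomp Require Export all_boot all_order all_algebra.
From mathcomp Require Export complex.
From mathcomp Require Export classical_sets reals.

Set Implicit Arguments.
Unset Strict Implicit.
Unset Printing Implicit Defensive.

Import Order.TTheory GRing.Theory Num.Theory.

Local Open Scope ring_scope.
Local Open Scope complex_scope.
Local Open Scope classical_set_scope.

(* The modulus of a complex number is real valued here: [`|z| : R[i]] is the
   same number, embedded in R[i]. *)
Notation modulus := ComplexField.Normc.normc.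

Definition vnorm2 (R : realType) (n : nat) (v : 'cV[R[i]]_n) : R :=
  Num.sqrt (\sum_i modulus (v i 0) ^+ 2).

(* The set is nonempty (take x = 0) and, the dimensions being finite, bounded,
   so the supremum is a genuine one; it is the operator norm subordinate to
   [vnorm2]. *)
Definition spectral_norm (R : realType) (m n : nat) (M : 'M[R[i]]_(m, n)) : R :=
  sup [set vnorm2 (M *m x) | x in [set x | vnorm2 x <= 1]].

Definition krylov (R : realType) (n : nat) (B : 'M[R[i]]_n) (y : 'cV[R[i]]_n)
    (k : nat) : {vspace 'cV[R[i]]_n} :=
  <<mkseq (fun i => B ^+ i *m y) k>>%VS.

(* A relation rather than a function: the minimizer need not be unique when B
   is singular. *)
Definition gmres_iterate (R : realType) (n : nat) (B : 'M[R[i]]_n)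
    (y : 'cV[R[i]]_n) (k : nat) (x : 'cV[R[i]]_n) : Prop :=
  x \in krylov B y k /\
  forall x', x' \in krylov B y k -> vnorm2 (y - B *m x) <= vnorm2 (y - B *m x').

Definition gmres_residual (R : realType) (n : nat) (B : 'M[R[i]]_n)
    (y : 'cV[R[i]]_n) (k : nat) (r : 'cV[R[i]]_n) : Prop :=
  exists2 x, gmres_iterate B y k x & r = y - B *m x.

(* Main.v *)
Require Import Defs.

Set Implicit Arguments.
Unset Strict Implicit.
Unset Printing Implicit Defensive.

Import Order.TTheory GRing.Theory Num.Theory.

Local Open Scope ring_scope.
Local Open Scope complex_scope.

(** One step of GMRES minimizes [vnorm2 (y - c *: (B *m y))] over the scalars
    [c], so any single choice of [c] bounds the residual from above
    ([gmres_residual1_min]).  Since [sigma] differs from [gamma ord0], the scalar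
    [lambda ord0] is invertible; for [c = (lambda ord0)^-1] the residual
    polynomial [1 - c t] vanishes at the eigenvalue [lambda ord0] of [B].  In the
    eigenvector coordinates [w] the vector [y - c *: (B *m y)] is therefore [Z *m u], where
    [u] has first entry [0] and [j]-th entry
    [(1 - lambda j / lambda ord0) * w j], and this factor equals
    [(gamma ord0 - gamma j) / (gamma ord0 - sigma)] because the shift cancels in
    the numerator.  Bounding the factors by their maximum bounds [u] by [w2]
    ([vnorm2_row'0], [vnorm2_le_scale]), and the spectral norm bounds the effect
    of [Z] ([vnorm2_mulmx_le]).  The last point needs the supremum that defines
    the spectral norm to be finite ([vnorm2_mulmx_bounded]). *)

Section Norms.
Variable R : realType.
Implicit Types m n : nat.

Lemma modulus_ge0 (z : R[i]) : 0 <= modulus z.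
Proof. by case: z => a b; exact: sqrtr_ge0. Qed.

Lemma modulus_sum n (F : 'I_n -> R[i]) :
  modulus (\sum_i F i) <= \sum_i modulus (F i).
Proof.
elim/big_ind2: _ => [|x1 x2 y1 y2 h1 h2|//].
  by rewrite ComplexField.Normc.normc0.
by apply: le_trans (le_normcD _ _) _; exact: lerD.
Qed.

Lemma vnorm2_ge0 n (v : 'cV[R[i]]_n) : 0 <= vnorm2 v.
Proof. exact: sqrtr_ge0. Qed.

Lemma vnorm2_le_scale n (c : R) (u v : 'cV[R[i]]_n) :
  0 <= c -> (forall i, modulus (u i 0) <= c * modulus (v i 0)) ->
  vnorm2 u <= c * vnorm2 v.
Proof.
move=> c0 huv; rewrite /vnorm2 -{1}(ger0_norm c0) -sqrtr_sqr -sqrtrM ?sqr_ge0//.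
rewrite ler_wsqrtr// mulr_sumr ler_sum// => i _.
by rewrite -exprMn lerXn2r ?nnegrE ?mulr_ge0 ?modulus_ge0.
Qed.

Lemma modulus_le_vnorm2 n (v : 'cV[R[i]]_n) i : modulus (v i 0) <= vnorm2 v.
Proof.
rewrite -(ger0_norm (modulus_ge0 (v i 0))) -sqrtr_sqr ler_wsqrtr//.
by rewrite (bigD1 i)//= lerDl sumr_ge0// => j _; exact: sqr_ge0.
Qed.

Lemma vnorm2_eq0 n (v : 'cV[R[i]]_n) : vnorm2 v = 0 -> v = 0.
Proof.
move=> v0; apply/matrixP => i j; rewrite ord1 mxE.
apply: ComplexField.Normc.eq0_normc; apply/eqP.
by rewrite eq_le modulus_ge0 andbT -v0 modulus_le_vnorm2.
Qed.

Lemma vnorm2_0 n : vnorm2 (0 : 'cV[R[i]]_n) = 0.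
Proof.
rewrite /vnorm2 big1 ?sqrtr0// => i _.
by rewrite mxE ComplexField.Normc.normc0 expr0n.
Qed.

Lemma vnorm2Z n (a : R) (v : 'cV[R[i]]_n) :
  0 <= a -> vnorm2 (a%:C *: v) = a * vnorm2 v.
Proof.
move=> a0; rewrite /vnorm2 -[in RHS](ger0_norm a0) -sqrtr_sqr -sqrtrM ?sqr_ge0//.
rewrite mulr_sumr; congr (Num.sqrt _); apply: eq_bigr => i _.
by rewrite mxE ComplexField.Normc.normcM exprMn /= expr0n addr0 sqr_sqrtr ?sqr_ge0.
Qed.

Lemma vnorm2_row'0 n (v : 'cV[R[i]]_n.+1) :
  v ord0 0 = 0 -> vnorm2 v = vnorm2 (row' ord0 v).
Proof.
move=> v0; rewrite /vnorm2 big_ord_recl v0 ComplexField.Normc.normc0 expr0n add0r.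
by congr (Num.sqrt _); apply: eq_bigr => i _; rewrite mxE.
Qed.

(** On the unit ball every entry of [x] has modulus at most [1], so the row sums
    of the moduli of [M] bound the entries of [M *m x]. *)
Lemma vnorm2_mulmx_bounded m n (M : 'M[R[i]]_(m, n)) :
  has_ubound [set vnorm2 (M *m x) | x in [set x | vnorm2 x <= 1]]%classic.
Proof.
exists (Num.sqrt (\sum_i (\sum_j modulus (M i j)) ^+ 2)) => _ [x /= x1 <-].
rewrite ler_wsqrtr// ler_sum// => i _.
rewrite lerXn2r ?nnegrE ?modulus_ge0 ?sumr_ge0// => [j _|]; first exact: modulus_ge0.
rewrite mxE; apply: le_trans (modulus_sum _) _; apply: ler_sum => j _.
rewrite ComplexField.Normc.normcM ler_piMr ?modulus_ge0//.
exact: le_trans (modulus_le_vnorm2 _ _) x1.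
Qed.

(** By homogeneity it suffices to look at [x] scaled to norm [1]. *)
Lemma vnorm2_mulmx_le m n (M : 'M[R[i]]_(m, n)) (x : 'cV[R[i]]_n) :
  vnorm2 (M *m x) <= spectral_norm M * vnorm2 x.
Proof.
have [/vnorm2_eq0 ->|x0] := eqVneq (vnorm2 x) 0.
  by rewrite mulmx0 !vnorm2_0 mulr0.
have xgt0 : 0 < vnorm2 x by rewrite lt_def x0 vnorm2_ge0.
have nx_ge0 : 0 <= (vnorm2 x)^-1 by rewrite invr_ge0 ltW.
rewrite -ler_pdivrMr// mulrC -vnorm2Z// scalemxAr.
apply: ub_le_sup; first exact: vnorm2_mulmx_bounded.
by exists ((vnorm2 x)^-1%:C *: x) => //=; rewrite vnorm2Z// mulVf.
Qed.

Lemma spectral_norm_ge0 m n (M : 'M[R[i]]_(m, n)) : 0 <= spectral_norm M.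
Proof.
apply: ub_le_sup; first exact: vnorm2_mulmx_bounded.
by exists 0; rewrite /= ?mulmx0 vnorm2_0.
Qed.

End Norms.

(** The first Krylov space is the line through [y], hence contains every
    multiple of [y]. *)
Lemma gmres_residual1_min (R : realType) (n : nat) (B : 'M[R[i]]_n)
    (y r : 'cV[R[i]]_n) (c : R[i]) :
  gmres_residual B y 1 r -> vnorm2 r <= vnorm2 (y - c *: (B *m y)).
Proof.
case=> x [_ xmin] ->; rewrite scalemxAr; apply: xmin.
by rewrite memvZ// /krylov memv_span// inE mul1mx.
Qed.

(* The dimension is n.+2; the index written 1 on paper is ord0, and the index
   set {2, ..., dimension} is {j | j != ord0}. The maximum is over a nonempty
   set of nonnegative reals, so its default value 0 is harmless. *)
Theorem mainTheorem2 (R : realType) (n : nat)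
    (A : 'M[R[i]]_n.+2) (gamma : 'I_n.+2 -> R[i])
    (hA : diagonalizable A)
    (hgamma : char_poly A = \prod_j ('X - (gamma j)%:P))
    (sigma : R[i]) (hsigma : sigma <> gamma ord0)
    (lambda : 'I_n.+2 -> R[i]) (hlambda : forall j, lambda j = gamma j - sigma)
    (B Z : 'M[R[i]]_n.+2) (hB : B = A - sigma%:M)
    (hZ : Z \in unitmx)
    (hBZ : B = Z *m diag_mx (\row_j lambda j) *m invmx Z)
    (y : 'cV[R[i]]_n.+2) (hy : vnorm2 y = 1)
    (w : 'cV[R[i]]_n.+2) (hw : w = invmx Z *m y)
    (w2 : 'cV[R[i]]_n.+1) (hw2 : w2 = row' ord0 w)
    (r1 : 'cV[R[i]]_n.+2) (hr1 : gmres_residual B y 1 r1)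
    (C2 : R)
    (hC2 : C2 = spectral_norm Z *
       \big[Num.max/0]_(j < n.+2 | j != ord0)
          (modulus (gamma ord0 - gamma j) / modulus (gamma ord0 - sigma))) :
  vnorm2 r1 <= C2 * vnorm2 w2.
Proof.
set g := fun j => (gamma ord0 - gamma j) / (gamma ord0 - sigma).
have d0 : gamma ord0 - sigma != 0.
  by rewrite subr_eq0; apply/eqP => h; exact: hsigma.
pose u : 'cV[R[i]]_n.+2 := \col_j (g j * w j 0).
have yE : y = Z *m w by rewrite hw mulKVmx.
have resE : y - (lambda ord0)^-1 *: (B *m y) = Z *m u.
  rewrite hBZ -mulmxA -hw -mulmxA [in LHS]yE scalemxAr -mulmxBr; congr (_ *m _).
  apply/matrixP => j k; rewrite ord1 mul_diag_mx !mxE !hlambda /g.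
  rewrite mulrA -{1}[w j 0]mul1r -mulrBl -{1}(divff d0) [_^-1 * _]mulrC -mulrBl.
  by congr (_ / _ * _); rewrite opprB addrA subrK.
set C := \big[_/_]_(_ < _ | _) _ in hC2.
have gC j : j != ord0 -> modulus (g j) <= C.
  move=> j0; rewrite ComplexField.Normc.normcM ComplexField.Normc.normcV.
  exact: (le_bigmax_cond 0
    (fun j => modulus (gamma ord0 - gamma j) / modulus (gamma ord0 - sigma)) j0).
have C0 : 0 <= C by apply: le_trans (gC (lift ord0 ord0) _); rewrite ?modulus_ge0.
have uw2 : vnorm2 u <= C * vnorm2 w2.
  rewrite vnorm2_row'0; last by rewrite mxE /g subrr !mul0r.
  apply: vnorm2_le_scale => // i.
  rewrite hw2 !mxE ComplexField.Normc.normcM.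
  by rewrite ler_wpM2r ?modulus_ge0// gC.
apply: le_trans (gmres_residual1_min (lambda ord0)^-1 hr1) _.
rewrite resE hC2 -mulrA; apply: le_trans (vnorm2_mulmx_le _ _) _.
by rewrite ler_wpM2l ?spectral_norm_ge0.
Qed.
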